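(* Let $\mathcal H$ be a real Hilbert space, $\rho\in\,]0,+\infty]$, and let $S\subset\mathcal H$ be a $\rho$-uniformly prox-regular set. Then: (a) Let $x_n\to x\in U_\rho(S)$. For any sequence $(z_n)$ and any sequences of positive numbers $(\varepsilon_n)$ and $(\eta_n)$ converging to $0$ with $z_n\in\operatorname{proj}_S^{\varepsilon_n,\eta_n}(x_n)$ for all $n\in\mathbb N$, one has $z_n\to\operatorname{proj}_S(x)$. (b) Suppose $\rho<+\infty$. Let $\gamma\in\,]0,1[$ and $\eta\in\,]0,\rho[$. Assume that $\eta\in\,]0,\eta_0[$ and $\varepsilon\in\,]0,\varepsilon_0]$, where $\eta_0,\varepsilon_0>0$ are such that $$\gamma+4\beta_0\Big(1+\frac1\rho\Big)+\frac{3\eta_0}{2}+\Big(\frac{4\beta_0}{\rho}+\gamma\Big)(4\beta_0+2\eta_0)=1,$$ with $\beta_0:=\sqrt{\varepsilon_0}+\eta_0+\sqrt{2\eta_0\gamma\rho}$. Then, for all $x_1,x_2\in U_\rho^\gamma(S)$ and all $z_i\in\operatorname{proj}_S^{\varepsilon,\eta}(x_i)$, $i\in\{1,2\}$, $$(1-\digamma)\|z_1-z_2\|^2\le\Big(\sqrt{\varepsilon'}+\frac\eta2\Big)\|x_1-x_2\|^2+M\sqrt{\varepsilon'}+N\eta+\langle x_1-x_2,z_1-z_2\rangle,$$ where $\alpha:=\max\{d_S(x_1),d_S(x_2)\}$, $\varepsilon':=\varepsilon+2\eta(\alpha+\sqrt\varepsilon)+\eta^2$, $$\digamma:=\frac\alpha\rho+4\sqrt{\varepsilon'}\Big(1+\frac1\rho\Big)+\frac{3\eta}{2}+\Big(\frac{4\sqrt{\varepsilon'}+\alpha}{\rho}\Big)\big(4\sqrt{\varepsilon'}+2\eta\big),$$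 $$M:=\Big(\frac{4\sqrt{\varepsilon'}+\alpha}{\rho}\Big)\big(16\sqrt{\varepsilon'}+16\eta+4\big)+24\sqrt{\varepsilon'}+20\eta+11,\qquad N:=\Big(\frac{4\sqrt{\varepsilon'}+\alpha}{\rho}\Big)(4\eta+2)+4\eta+5.$$
   Context: $\mathbb B$ is the closed unit ball of $\mathcal H$; $d_S(x)=\inf_{z\in S}\|x-z\|$; $U_\rho(S)=\{x:d_S(x)<\rho\}$ and $U_\rho^\gamma(S)=\{x:d_S(x)<\gamma\rho\}$. The proximal normal cone $N^P(S;x)$ at $x\in S$ is the set of $\zeta\in\mathcal H$ for which there are $\sigma\ge0$, $r>0$ with $\langle\zeta,y-x\rangle\le\sigma\|y-x\|^2$ for all $y\in S$ with $\|y-x\|<r$. A closed set $S\subset\mathcal H$ is $\rho$-uniformly prox-regular (with $1/\rho=0$ if $\rho=+\infty$) if for all $x\in S$ and $\zeta\in N^P(S;x)$ one has $\langle\zeta,x'-x\rangle\le\frac{\|\zeta\|}{2\rho}\|x'-x\|^2$ for all $x'\in S$. For such $S$ every $x\in U_\rho(S)$ has a unique nearest point in $S$, denoted $\operatorname{proj}_S(x)$ (known fact). For $\varepsilon,\eta>0$, $\operatorname{proj}_S^{\varepsilon,\eta}(x):=\{z\in S_\eta:\|x-z\|^2<d_S^2(x)+\varepsilon\}$, where $S_\eta$ is any (arbitrarily chosen) closed set with $S\subset S_\eta\subset S+\eta\mathbb B$. *)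

(* Defs.v *)
From HB Require Import structures.
From mathcomp Require Import all_boot all_order all_algebra.
From mathcomp Require Import all_classical all_reals all_analysis.

Set Implicit Arguments.
Unset Strict Implicit.
Unset Printing Implicit Defensive.

Import Order.TTheory GRing.Theory Num.Theory.
Import numFieldNormedType.Exports.

Local Open Scope classical_set_scope.
Local Open Scope ring_scope.

(* A complete normed space together with a (symmetric, positive definite) form
   inducing its norm is a real Hilbert space. *)
Definition induces_norm (R : realType) (H : completeNormedModType R)
    (dot : {dot H for idfun}) : Prop :=
  forall u : H, `|u| ^+ 2 = dot u u.

(* Valued in \bar R, so that the distance to the empty set is +oo. *)
Definition dist_set (R : realType) (H : normedModType R) (S : set H) (x : H) :
    \bar R :=
  ereal_inf [set (`|x - z|)%:E | z in S].

(* U_rho(S) is [tube S rho], and U_rho^gamma(S) is [tube S (gamma * rho)]. *)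
Definition tube (R : realType) (H : normedModType R) (S : set H)
    (rho : \bar R) : set H :=
  [set x | (dist_set S x < rho)%E].

Definition prox_normal_cone (R : realType) (H : completeNormedModType R)
    (dot : {dot H for idfun}) (S : set H) (x : H) : set H :=
  [set zeta | exists sigma r : R, [/\ 0 <= sigma, 0 < r &
    forall y, S y -> `|y - x| < r -> dot zeta (y - x) <= sigma * `|y - x| ^+ 2]].

(* For rho = +oo, [rho^-1] is 0. *)
Definition prox_regular (R : realType) (H : completeNormedModType R)
    (dot : {dot H for idfun}) (rho : \bar R) (S : set H) : Prop :=
  closed S /\
  forall x zeta, S x -> prox_normal_cone dot S x zeta ->
  forall x', S x' ->
    dot zeta (x' - x) <= `|zeta| / 2 * fine (rho^-1)%E * `|x' - x| ^+ 2.

Definition nearest_points (R : realType) (H : normedModType R) (S : set H)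
    (x : H) : set H :=
  [set z | S z /\ (`|x - z|)%:E = dist_set S x].

(* The nearest point of S to x; only meaningful when it exists and is unique,
   as is the case on U_rho(S) for a rho-uniformly prox-regular set S. *)
Definition metric_proj (R : realType) (H : normedModType R) (S : set H) (x : H) : H :=
  xget x (nearest_points S x).

(* [Seta eta] is the chosen closed set S_eta, for each eta > 0. *)
Definition closed_approximation (R : realType) (H : normedModType R)
    (S : set H) (Seta : R -> set H) : Prop :=
  forall eta : R, 0 < eta ->
    [/\ closed (Seta eta), S `<=` Seta eta &
        Seta eta `<=`
          [set s + eta *: b | s in S & b in [set b : H | `|b| <= 1]]].

Definition approx_proj (R : realType) (H : normedModType R) (S : set H)
    (Seta : R -> set H) (eps eta : R) (x : H) : set H :=
  [set z | Seta eta z /\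
           ((`|x - z| ^+ 2)%:E < dist_set S x ^+ 2 + eps%:E)%E].

(* Main.v *)
Require Import Defs.
From mathcomp Require Import all_boot all_order all_algebra.
From mathcomp Require Import all_classical all_reals all_analysis.
From mathcomp Require Import ring lra.
Import Order.TTheory GRing.Theory Num.Theory.
Import numFieldNormedType.Exports.
Local Open Scope classical_set_scope.
Local Open Scope ring_scope.

Set Implicit Arguments.
Unset Strict Implicit.
Unset Printing Implicit Defensive.

(** Write d for the distance to S, and let K stand for 1 / rho.

    The starting point is that nearest points are strong minimizers: if w is a
    nearest point of y, then y - w is a proximal normal at w, and prox-regularity
    turns into the growth estimate
    (1 - d(y) K) |s - w|^2 <= |y - s|^2 - d(y)^2 for s in S ([nearest_growth]).
    When d(y) < rho, almost minimizers therefore lie close to w.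

    This presupposes that nearest points exist, which in infinite dimension is
    not automatic for a closed set.  For an arbitrary nonempty closed S, moving x
    slightly towards an almost nearest point s forces all almost nearest points
    of the new centre to gather near s.  By Baire's theorem the nearest-point
    problem is then well posed at a dense set of centres ([well_posed_dense]).
    Transporting the growth estimate from one such centre to a neighbouring point
    x of the tube gives well-posedness at every point of the tube
    ([tube_well_posed]): minimizing sequences are Cauchy, the projection exists,
    and they converge to it.  Part (a) is this convergence, applied to points s_n
    of S at distance at most eta_n from z_n.

    For (b), replace z_i by s_i in S with |z_i - s_i| <= eta; then s_i minimizes
    |x_i - .|^2 on S up to eps'.  Put e = sqrt eps'.  A direct comparison of s_i
    with the projection of x_i would cost the factor 1 / (1 - d K), which is not
    uniformly bounded.  Instead let w_i be the projection of the midpoint of x_i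
    and s_i, i.e. the minimizer over S of |x_i - .|^2 + |s_i - .|^2
    ([exists_nearby_normal]).  This quadratic perturbation is a Hilbertian form of
    the smooth variational principle: |s_i - w_i| <= e, and the vector
    x_i - w_i + (s_i - w_i), of norm at most d(x_i) + e, is normal at w_i.
    Adding the two prox-regularity inequalities at w_1 and w_2 gives
    hypomonotonicity for w_1 - w_2 with error 2 e |w_1 - w_2|
    ([normal_hypomonotone]).  Passing from w_i to z_i costs terms that are linear
    in 2 e + 2 eta and are absorbed by Young's inequality
    ([hypomonotone_perturbed]).  The assumption linking gamma, eta0 and eps0
    yields e <= beta0, hence that the factor 1 - F is nonnegative and that the
    midpoints lie in the tube. *)

(** * Inner product identities *)

Section InnerProduct.
Variables (R : realType) (H : completeNormedModType R).
Variables (dot : {dot H for idfun}) (Hdot : induces_norm dot).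
Implicit Types u v : H.

Lemma dot_sym u v : dot u v = dot v u.
Proof. by rewrite hermC /= expr0 mul1r. Qed.

Lemma normD_sqr u v : `|u + v| ^+ 2 = `|u| ^+ 2 + 2 * dot u v + `|v| ^+ 2.
Proof. rewrite !Hdot linearDl !linearDr /= (dot_sym v u); ring. Qed.

Lemma normB_sqr u v : `|u - v| ^+ 2 = `|u| ^+ 2 - 2 * dot u v + `|v| ^+ 2.
Proof. by rewrite normD_sqr normrN linearNr mulrN. Qed.

Lemma dot_le_norm u v : dot u v <= `|u| * `|v|.
Proof.
have : `|u + v| ^+ 2 <= (`|u| + `|v|) ^+ 2 by rewrite lerXn2r ?nnegrE ?addr_ge0 ?ler_normD.
rewrite normD_sqr; nra.
Qed.

Lemma dot_ge_norm u v : - (`|u| * `|v|) <= dot u v.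
Proof. by rewrite lerNl -linearNr -(normrN v) dot_le_norm. Qed.

Lemma dotZl (k : R) u v : dot (k *: u) v = k * dot u v.
Proof. exact: (linearZl_LR dot). Qed.

Lemma dotZr (k : R) u v : dot u (k *: v) = k * dot u v.
Proof. exact: (linearZr_LR dot). Qed.
End InnerProduct.

(** * The distance to a set, as a real number *)

Section Dist.
Variables (R : realType) (H : normedModType R).
Implicit Types (S : set H) (x y s : H).

Definition rdist S x : R := fine (dist_set S x).

Lemma dist_set_ge0 S x : (0 <= dist_set S x)%E.
Proof. by apply: le_ereal_inf_tmp => _ [z _ <-]; rewrite lee_fin. Qed.

Lemma rdist_ge0 S x : 0 <= rdist S x.
Proof. by rewrite fine_ge0 ?dist_set_ge0. Qed.

Lemma rdistE S x : S !=set0 -> dist_set S x = (rdist S x)%:E.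
Proof.
move=> [s Ss]; rewrite fineK // ge0_fin_numE ?dist_set_ge0 //.
by apply: (@le_lt_trans _ _ (`|x - s|)%:E); [apply: ereal_inf_lbound; exists s | rewrite ltry].
Qed.

Lemma rdist_le S x s : S s -> rdist S x <= `|x - s|.
Proof.
move=> Ss; rewrite -lee_fin -rdistE; last by exists s.
by apply: ereal_inf_lbound; exists s.
Qed.

Lemma rdist_approx S x (e : R) : S !=set0 -> 0 < e ->
  exists2 s, S s & `|x - s| < rdist S x + e.
Proof.
move=> S0 e0; have : (dist_set S x < (rdist S x + e)%:E)%E.
  by rewrite rdistE // lte_fin ltrDl.
by move=> /ereal_inf_lt[_ [s Ss <-]]; rewrite lte_fin => ?; exists s.
Qed.

Lemma rdist_lip S x y : S !=set0 -> rdist S y <= rdist S x + `|x - y|.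
Proof.
move=> S0; apply/ler_addgt0Pr => e e0; have [s Ss xs] := rdist_approx x S0 e0.
apply: (le_trans (rdist_le y Ss)); rewrite distrC.
have := ler_distD x y s; rewrite (distrC y x) (distrC s y); lra.
Qed.

Lemma nearest_pointsE S x p : nearest_points S x p <-> S p /\ `|x - p| = rdist S x.
Proof.
have E : S p -> dist_set S x = (rdist S x)%:E by move=> Sp; apply: rdistE; exists p.
by split=> -[Sp] h; split => //; [move: h; rewrite (E Sp) => -[] | rewrite (E Sp) h].
Qed.

(** Well-posedness at the scale k only: unlike well-posedness itself, this is an
    open condition on x, as Baire's theorem requires. *)
Definition clustered S (k : R) : set H := [set x | exists2 d : R, 0 < d &
  forall s s', S s -> S s' ->
    `|x - s| < rdist S x + d -> `|x - s'| < rdist S x + d -> `|s - s'| < k].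

(** Well-posedness in the sense of Tykhonov: the diameters of the approximate
    solution sets shrink to 0. *)
Definition well_posed S x := forall k : R, 0 < k -> clustered S k x.
End Dist.

Lemma well_posed_nearest (R : realType) (H : completeNormedModType R)
    (S : set H) (x : H) :
  closed S -> S !=set0 -> well_posed S x -> nearest_points S x !=set0.
Proof.
move=> cS S0 wp.
have /choice[u uP] : forall n : nat, exists s, S s /\ `|x - s| < rdist S x + n.+1%:R^-1.
  move=> n; have [s Ss xs] := rdist_approx x S0 (e := n.+1%:R^-1) ltac:(by rewrite invr_gt0).
  by exists s.
have uc : cvgn u.
  apply: cauchy_cvg; apply/cauchyP => /= e e0.
  have [d d0 dP] := wp _ e0.
  have [N _ NP] : \forall n \near \oo, n.+1%:R^-1 < d :> R
    by exact: near_infty_natSinv_lt (PosNum d0).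
  exists (u N); exists N => // n /= Nn; rewrite -ball_normE /=.
  have [SN N1] := uP N; have [Sn n1] := uP n.
  apply: dP => //; first by apply: (lt_trans N1); rewrite ltrD2l; exact: NP (leqnn N).
  by apply: (lt_trans n1); rewrite ltrD2l; exact: NP.
exists (limn u); apply/nearest_pointsE; split.
  apply: (closed_cvg _ cS) uc.
  by near=> n; have [] := uP n.
apply/eqP; rewrite eq_le; apply/andP; split; last first.
  apply: rdist_le; apply: (closed_cvg _ cS) uc.
  by near=> n; have [] := uP n.
apply/ler_addgt0Pr => e e0.
have cn : (fun n => `|x - u n|) @ \oo --> `|x - limn u|.
  by apply: cvg_norm; apply: cvgB => //; exact: cvg_cst.
apply: (cvgr_to_le cn).
near=> n; have [_ /ltW h] := uP n; apply: (le_trans h); rewrite lerD2l ltW//.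
by near: n; exact: near_infty_natSinv_lt (PosNum e0).
Unshelve. all: by end_near. Qed.

(** * Generic well-posedness of the nearest-point problem *)

Section Prox.
Variables (R : realType) (H : completeNormedModType R).
Variables (dot : {dot H for idfun}) (Hdot : induces_norm dot).
Implicit Types (S : set H) (x y s : H).

Lemma normB_convex_sqr (t : R) x s w :
  `|(1 - t) *: x + t *: s - w| ^+ 2 =
  (1 - t) * `|x - w| ^+ 2 + t * `|s - w| ^+ 2 - t * (1 - t) * `|x - s| ^+ 2.
Proof.
have -> : (1 - t) *: x + t *: s - w = (1 - t) *: (x - w) + t *: (s - w).
  rewrite !scalerBr addrACA -opprD -scalerDl subrK scale1r //.
have -> : x - s = (x - w) - (s - w) by rewrite opprB addrA subrK.
move: (x - w) (s - w) => a b.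
rewrite (normD_sqr Hdot (_ *: a)) (normB_sqr Hdot a) !normrZ !exprMn !real_normK ?num_real //.
rewrite dotZl dotZr; ring.
Qed.

Lemma normB_affine (t : R) x s : (1 - t) *: x + t *: s - s = (1 - t) *: (x - s).
Proof. by rewrite -addrA -[t *: s - s]opprB -[X in _ - (X - _)]scale1r -scalerBl -scalerBr. Qed.

(** Moving the centre from x towards an almost nearest point s makes s strongly
    preferred: the identity [normB_convex_sqr] contributes a term
    t |s - s'|^2 that penalizes every competitor s'. *)
Lemma segment_near_min (t e d : R) S x s s' : S s' ->
  0 < t < 1 -> 0 <= d ->
  `|x - s| ^+ 2 <= rdist S x ^+ 2 + e ->
  `|(1 - t) *: x + t *: s - s'| <= `|(1 - t) *: x + t *: s - s| + d ->
  t * `|s - s'| ^+ 2 <= (1 - t) * e + d * (2 * `|x - s| + d).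
Proof.
move=> Ss' /andP[t0 t1] d0 xs.
rewrite normB_affine normrZ gtr0_norm ?subr_gt0 // => h.
have h1 : `|(1 - t) *: x + t *: s - s'| ^+ 2 <= ((1 - t) * `|x - s| + d) ^+ 2.
  by rewrite lerXn2r ?nnegrE // addr_ge0 // mulr_ge0 // subr_ge0 ltW.
move: h1; rewrite normB_convex_sqr.
have h2 : rdist S x ^+ 2 <= `|x - s'| ^+ 2.
  by rewrite lerXn2r ?nnegrE ?rdist_ge0 ?rdist_le.
have n0 := normr_ge0 (x - s).
have := rdist_ge0 S x.
move: (`|x - s'|) (`|x - s|) (rdist S x) (`|s - s'|) xs h2 n0 => b a D c xs h2 n0 D0.
have h3 : (1 - t) * (a ^+ 2 - b ^+ 2) <= (1 - t) * e by rewrite ler_wpM2l; lra.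
have h5 : 0 <= t * (a * d) by rewrite !mulr_ge0 // ltW.
nra.
Qed.

Lemma exists_small_factor (A B : R) : 0 < A -> 0 < B ->
  exists d : R, [/\ 0 < d, d <= 1 & d * A <= B].
Proof.
move=> A0 B0; exists (Num.min 1 (B / A)); split.
- by rewrite lt_min ltr01 divr_gt0.
- by rewrite ge_min lexx.
- by rewrite -ler_pdivlMr // ge_min lexx orbT.
Qed.

Lemma clustered_open S k : S !=set0 -> open (clustered S k).
Proof.
move=> S0; rewrite openE => x [d d0 dP]; apply/nbhs_ballP.
exists (d / 3); first by rewrite /= divr_gt0.
move=> y; rewrite -ball_normE /= => xy; exists (d / 3); first by rewrite divr_gt0.
have near s : `|y - s| < rdist S y + d / 3 -> `|x - s| < rdist S x + d.
  by have := ler_distD y x s; have := rdist_lip x y S0; lra.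
by move=> s s' Ss Ss' ys ys'; apply: dP => //; exact: near.
Qed.

(** The new centre is (1 - t) x + t s, with t small enough to stay near x, and
    with s then chosen almost nearest to x compared with t. *)
Lemma clustered_dense S k : S !=set0 -> 0 < k -> dense (clustered S k).
Proof.
move=> S0 k0 O [x Ox] oO.
have /nbhs_ballP[tau /= tau0 tauP] : nbhs x O by exact: open_nbhs_nbhs.
set D := rdist S x; have D0 : 0 <= D by exact: rdist_ge0.
(* D + 1 bounds |x - s|, hence t (D + 1) bounds the displacement. *)
have [t [t0 t1 tP]] : exists t : R, [/\ 0 < t, t < 1 & t * (D + 1) < tau].
  have [t [t0 t1 tP]] := @exists_small_factor (D + 1) tau ltac:(lra) tau0.
  by exists (t / 2); split; lra.
have tk : 0 < t * (k / 3) ^+ 2 / 2 by rewrite divr_gt0 // mulr_gt0 // exprn_gt0 // divr_gt0.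
(* e and d are such that the error of [segment_near_min] is at most t (k / 3)^2. *)
have [e [e0 e1 eP]] := @exists_small_factor (2 * D + 1) _ ltac:(lra) tk.
have [d [d0 d1 dP]] := @exists_small_factor (2 * (D + 1) + 1) _ ltac:(lra) tk.
have [s Ss xs] := rdist_approx x S0 e0.
set y := (1 - t) *: x + t *: s.
exists y; split.
  apply: tauP; rewrite -ball_normE /=.
  have -> : x - y = t *: (x - s).
    apply/eqP; rewrite subr_eq addrC -subr_eq eq_sym; apply/eqP.
    by rewrite /y scalerBl scale1r scalerBr opprB addrA addrAC.
  rewrite normrZ gtr0_norm //; apply: le_lt_trans tP.
  by rewrite ler_pM2l // ltW // (lt_le_trans xs) // lerD2l.
have close s' : S s' -> `|y - s'| < rdist S y + d -> `|s - s'| <= k / 3.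
  move=> Ss' ys'.
  have xs2 : `|x - s| ^+ 2 <= D ^+ 2 + t * (k / 3) ^+ 2 / 2.
    by have := normr_ge0 (x - s); rewrite -/D in xs; nra.
  have ys : `|y - s'| <= `|y - s| + d.
    by rewrite (le_trans (ltW ys')) // lerD2r rdist_le.
  have := segment_near_min Ss' _ (ltW d0) xs2 ys.
  rewrite t0 t1 => /(_ isT) h.
  have : t * `|s - s'| ^+ 2 <= t * (k / 3) ^+ 2.
    apply: (le_trans h); have : d * (2 * `|x - s| + d) <= d * (2 * (D + 1) + 1).
      by rewrite ler_wpM2l ?ltW //; rewrite -/D in xs; lra.
    have : 0 <= t * (t * (k / 3) ^+ 2 / 2) by rewrite mulr_ge0 // ltW.
    lra.
  have k3 : 0 <= k / 3 by lra.
  by rewrite ler_pM2l // ler_pXn2r ?nnegrE.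
exists d => // s1 s2 S1 S2 /(close _ S1) h1 /(close _ S2) h2.
by have := ler_distD s s1 s2; rewrite (distrC s1 s); lra.
Qed.

(** Well-posed centres form the intersection over n of the open dense sets
    [clustered S n.+1%:R^-1]. *)
Lemma well_posed_dense S : S !=set0 -> dense (well_posed S).
Proof.
move=> S0; have i0 n : 0 < n.+1%:R^-1 :> R by rewrite invr_gt0.
have := @Baire R H (fun n => clustered S n.+1%:R^-1) (fun n =>
  conj (clustered_open _ S0) (clustered_dense S0 (i0 n))).
move=> + O O0 oO => /(_ O O0 oO)[x [Ox xP]]; exists x; split => // k k0.
have [n _ nP] : \forall n \near \oo, n.+1%:R^-1 < k :> R
  by exact: near_infty_natSinv_lt (PosNum k0).
have [d d0 dP] := xP n I; exists d => // s s' Ss Ss' h h'.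
by rewrite (lt_trans (dP _ _ Ss Ss' h h')) //; exact: nP (leqnn n).
Qed.

(** * Projections onto a prox-regular set *)

Lemma nearest_normal S x p : nearest_points S x p -> prox_normal_cone dot S p (x - p).
Proof.
move=> /nearest_pointsE[Sp xp]; exists (1 / 2), 1; split=> [||y Sy _] //.
have := rdist_le x Sy; rewrite -xp => h.
have : `|x - p| ^+ 2 <= `|x - p - (y - p)| ^+ 2.
  by rewrite opprB addrA subrK lerXn2r ?nnegrE.
rewrite (normB_sqr Hdot (x - p)); lra.
Qed.

Section ProxRegular.
Variables (rho : \bar R) (rho_gt0 : (0 < rho)%E) (S : set H).
Variables (HS : prox_regular dot rho S).
Let K : R := fine (rho^-1)%E.

Lemma curvature_ge0 : 0 <= K.
Proof.
rewrite /K; move: rho_gt0; case: rho => [r| |] //= r0; rewrite inver.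
by case: ifP => // _; rewrite /= invr_ge0 ltW.
Qed.

Lemma curvature_lt1 (d : R) : (d%:E < rho)%E -> d * K < 1.
Proof.
rewrite /K; move: rho_gt0; case: rho => [r| |] //= r0.
  rewrite !lte_fin in r0 * => dr; rewrite inver gt_eqF //= ltr_pdivrMr ?mul1r //.
by rewrite mulr0 ltr01.
Qed.

Lemma nearest_prox x p s : nearest_points S x p -> S s ->
  dot (x - p) (s - p) <= rdist S x / 2 * K * `|s - p| ^+ 2.
Proof.
move=> np Ss; have /nearest_pointsE[Sp <-] := np.
exact: HS.2 Sp (nearest_normal np) _ Ss.
Qed.

(** Expanding |x - s|^2 around p, the cross term is controlled by the
    prox-regularity inequality for the normal x - p. *)
Lemma nearest_growth x p s : nearest_points S x p -> S s ->
  (1 - rdist S x * K) * `|s - p| ^+ 2 <= `|x - s| ^+ 2 - rdist S x ^+ 2.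
Proof.
move=> np Ss; have := nearest_prox np Ss; have /nearest_pointsE[Sp xp] := np.
have -> : x - s = x - p - (s - p) by rewrite opprB addrA subrK.
rewrite (normB_sqr Hdot (x - p)) -xp; lra.
Qed.

Lemma tube_nonempty x : tube S rho x -> S !=set0.
Proof.
move=> h; have : (dist_set S x < +oo)%E by apply: (lt_le_trans h); rewrite leey.
by move=> /ereal_inf_lt[_ [s Ss _] _]; exists s.
Qed.

(** A well-posed centre y close to x has a nearest point p.  The growth estimate
    at y, whose constant stays above half of that at x, then forces all almost
    nearest points of x to lie near p. *)
Lemma tube_well_posed x : tube S rho x -> well_posed S x.
Proof.
move=> tx k k0; have S0 := tube_nonempty tx.
have := tx; rewrite /tube /= rdistE // => /curvature_lt1.
set D := rdist S x => DK.
have D0 : 0 <= D by exact: rdist_ge0.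
have K0 := curvature_ge0.
set c := 1 - D * K; have c0 : 0 < c by rewrite subr_gt0.
have ck0 : 0 < c / 2 * (k / 3) ^+ 2 by rewrite mulr_gt0 ?exprn_gt0 ?divr_gt0.
have [d [d0 d1 dP]] := @exists_small_factor (3 * (2 * D + 5) + K)
  (Num.min (c / 2) (c / 2 * (k / 3) ^+ 2)) ltac:(lra)
  ltac:(by rewrite lt_min ck0 divr_gt0).
move: dP; rewrite le_min => /andP[dc dk].
have [y [xy wy]] := well_posed_dense S0
  (ex_intro _ x (ballxx x d0) : ball x d !=set0) (ball_open x d).
move: xy; rewrite -ball_normE /= => xy.
have [p np] := well_posed_nearest HS.1 S0 wy.
have close s : S s -> `|x - s| < D + d -> `|s - p| <= k / 3.
  move=> Ss xs.
  have := nearest_growth np Ss.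
  have y1 := rdist_lip x y S0; have y2 := rdist_lip y x S0.
  rewrite (distrC y x) -/D in y1 y2.
  have ys : `|y - s| <= rdist S y + 3 * d.
    by have := ler_distD x y s; rewrite (distrC y x); lra.
  have D'0 := rdist_ge0 S y.
  have ys2 : `|y - s| ^+ 2 <= (rdist S y + 3 * d) ^+ 2.
    by rewrite lerXn2r ?nnegrE //; lra.
  have c2 : c / 2 <= 1 - rdist S y * K by rewrite /c in dc *; nra.
  have h1 : c / 2 * `|s - p| ^+ 2 <= (1 - rdist S y * K) * `|s - p| ^+ 2.
    by rewrite ler_wpM2r ?exprn_ge0.
  have h2 : 3 * d * (2 * rdist S y + 3 * d) <= 3 * d * (2 * D + 5).
    by rewrite ler_wpM2l; lra.
  have h3 : 0 <= d * K by rewrite mulr_ge0 // ltW.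
  move=> h; have : c / 2 * `|s - p| ^+ 2 <= c / 2 * (k / 3) ^+ 2.
    lra.
  have k3 : 0 <= k / 3 by lra.
  by rewrite ler_pM2l ?divr_gt0 // ler_pXn2r ?nnegrE.
exists d => // s1 s2 S1 S2 /(close _ S1) h1 /(close _ S2) h2.
by have := ler_distD p s1 s2; rewrite (distrC p s2); lra.
Qed.

Lemma tube_nearest x : tube S rho x -> nearest_points S x !=set0.
Proof.
by move=> tx; apply: well_posed_nearest HS.1 (tube_nonempty tx) (tube_well_posed tx).
Qed.

Lemma metric_proj_nearest x : tube S rho x -> nearest_points S x (metric_proj S x).
Proof. by move=> /tube_nearest[p ?]; apply: xgetPex; exists p. Qed.

(** * Approximate projections *)

(** Replacing z in the enlarged set by a point of S within eta turns the tolerance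
    eps into eps' = eps + 2 eta (d + sqrt eps) + eta^2. *)
Lemma approx_proj_shadow (Seta : R -> set H) (eps eta : R) x z :
  closed_approximation S Seta -> S !=set0 -> 0 < eps -> 0 < eta ->
  approx_proj S Seta eps eta x z ->
  exists s, [/\ S s, `|z - s| <= eta & `|x - s| ^+ 2 <=
    rdist S x ^+ 2 + (eps + 2 * eta * (rdist S x + Num.sqrt eps) + eta ^+ 2)].
Proof.
move=> HSeta S0 eps0 eta0 [Sz]; rewrite rdistE // -EFin_expe -EFinD lte_fin => xz.
have [_ _ /(_ _ Sz)[s Ss [b /= b1 zE]]] := HSeta _ eta0.
have zs : `|z - s| <= eta.
  by rewrite -zE addrC addKr normrZ gtr0_norm // ler_piMr // ltW.
exists s; split => //.
have D0 := rdist_ge0 S x; have q0 := sqrtr_ge0 eps.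
have xz1 : `|x - z| <= rdist S x + Num.sqrt eps.
  rewrite -(@ler_pXn2r _ 2) ?nnegrE ?addr_ge0 //; apply: (le_trans (ltW xz)).
  have := mulr_ge0 D0 q0; have := sqr_sqrtr (ltW eps0); nra.
have : `|x - s| ^+ 2 <= (`|x - z| + eta) ^+ 2.
  rewrite ler_pXn2r ?nnegrE ?addr_ge0 ?(ltW eta0) //.
  by have := ler_distD z x s; lra.
have : eta * `|x - z| <= eta * (rdist S x + Num.sqrt eps) by rewrite ler_pM2l.
lra.
Qed.

Lemma approx_proj_cvg (Seta : R -> set H) (HSeta : closed_approximation S Seta)
    (x_ z_ : nat -> H) (x : H) (eps_ eta_ : nat -> R) :
  x_ @ \oo --> x -> tube S rho x ->
  (forall n, 0 < eps_ n) -> (forall n, 0 < eta_ n) ->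
  eps_ @ \oo --> (0 : R) -> eta_ @ \oo --> (0 : R) ->
  (forall n, approx_proj S Seta (eps_ n) (eta_ n) (x_ n) (z_ n)) ->
  z_ @ \oo --> metric_proj S x.
Proof.
move=> xx tx eps0 eta0 epsc etac zP.
have S0 := tube_nonempty tx.
have /nearest_pointsE[Sp xp] := metric_proj_nearest tx.
apply/cvgrPdist_lt => k k0.
have k20 : 0 < k / 2 by rewrite divr_gt0.
have [d d0 dP] := tube_well_posed tx k20.
have d40 : 0 < d / 4 by rewrite divr_gt0.
near=> n.
have [s [Ss zs xs2]] := approx_proj_shadow HSeta S0 (eps0 n) (eta0 n) (zP n).
have D0 := rdist_ge0 S (x_ n); have q0 := sqrtr_ge0 (eps_ n); have e0 := ltW (eta0 n).
have xs : `|x_ n - s| <= rdist S (x_ n) + Num.sqrt (eps_ n) + eta_ n.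
  rewrite -(@ler_pXn2r _ 2) ?nnegrE ?addr_ge0 //; apply: (le_trans xs2).
  have := mulr_ge0 D0 q0; have := sqr_sqrtr (ltW (eps0 n)); nra.
have h1 : `|x - x_ n| < d / 4 by near: n; exact: cvgr_dist_lt xx _ d40.
have h2 : eta_ n < Num.min (d / 4) (k / 2).
  by near: n; apply: (cvgr_lt _ etac); rewrite lt_min d40.
have h3 : Num.sqrt (eps_ n) < d / 4.
  rewrite -(ger0_norm (ltW d40)) -sqrtr_sqr ltr_sqrt ?exprn_gt0 //.
  by near: n; apply: (cvgr_lt _ epsc); rewrite exprn_gt0.
move: h2; rewrite lt_min => /andP[h2 h4].
have h5 : `|metric_proj S x - s| < k / 2.
  apply: dP => //; first by rewrite xp ltrDl.
  by have := ler_distD (x_ n) x s; have := rdist_lip x (x_ n) S0; lra.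
by have := ler_distD s (metric_proj S x) (z_ n); rewrite (distrC s (z_ n)); lra.
Unshelve. all: by end_near. Qed.

(** * Hypomonotonicity of approximate projections *)

(** The point w is the projection of the midpoint y of x and s, and the normal
    vector is 2 (y - w).  As the factor (1 - t) / t equals 1 for t = 1 / 2, no
    constant is lost in |s - w| <= e. *)
Lemma exists_nearby_normal x s (e : R) : S s -> 0 <= e ->
  `|x - s| ^+ 2 <= rdist S x ^+ 2 + e ^+ 2 ->
  (((rdist S x + e) / 2)%:E < rho)%E ->
  exists w, [/\ S w, `|s - w| <= e & forall s', S s' ->
    dot (x - w + (s - w)) (s' - w) <= (rdist S x + e) / 2 * K * `|s' - w| ^+ 2].
Proof.
move=> Ss e0 xs small; have D0 := rdist_ge0 S x.
have xs1 : `|x - s| <= rdist S x + e.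
  rewrite -(@ler_pXn2r _ 2) ?nnegrE ?addr_ge0 //.
  by have := mulr_ge0 D0 e0; nra.
set y := (1 - 1 / 2) *: x + (1 / 2) *: s.
have ys : `|y - s| = `|x - s| / 2.
  by rewrite normB_affine normrZ gtr0_norm; lra.
have dy : rdist S y <= (rdist S x + e) / 2.
  by apply: (le_trans (rdist_le y Ss)); rewrite ys; lra.
have ty : tube S rho y.
  by rewrite /tube /= rdistE; [apply: le_lt_trans small; rewrite lee_fin | exists s].
have [w nw] := tube_nearest ty; have /nearest_pointsE[Sw yw] := nw.
exists w; split => //.
  have h : `|y - w| <= `|y - s| + 0 by rewrite addr0 yw rdist_le.
  have := segment_near_min Sw _ (lexx 0) xs h.
  rewrite mul0r addr0 => /(_ ltac:(apply/andP; split; lra)).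
  rewrite [X in _ <= X * _ -> _](_ : _ = 1 / 2); last lra.
  by rewrite ler_pM2l // ler_pXn2r ?nnegrE.
move=> s' Ss'; have := nearest_prox nw Ss'.
have -> : x - w + (s - w) = 2 *: (y - w).
  rewrite /y scalerBr scalerDr !scalerA.
  rewrite (_ : 2 * (1 - 1 / 2) = 1); last lra.
  rewrite (_ : 2 * (1 / 2) = 1); last lra.
  by rewrite !scale1r scaler_nat mulr2n opprD addrACA.
rewrite dotZl => h.
have : rdist S y * (K * `|s' - w| ^+ 2) <= (rdist S x + e) / 2 * (K * `|s' - w| ^+ 2).
  by rewrite ler_wpM2r // mulr_ge0 ?curvature_ge0 ?exprn_ge0.
lra.
Qed.

(** Sum of the two normal inequalities; s1 - w1 and s2 - w2 each contribute an error
    of at most e |w1 - w2|. *)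
Lemma normal_hypomonotone x1 x2 s1 s2 w1 w2 (a e : R) :
  0 <= e -> S w1 -> S w2 ->
  `|s1 - w1| <= e -> `|s2 - w2| <= e ->
  dot (x1 - w1 + (s1 - w1)) (w2 - w1) <= a / 2 * K * `|w2 - w1| ^+ 2 ->
  dot (x2 - w2 + (s2 - w2)) (w1 - w2) <= a / 2 * K * `|w1 - w2| ^+ 2 ->
  (1 - a * K) * `|w1 - w2| ^+ 2 <= dot (x1 - x2) (w1 - w2) + 2 * e * `|w1 - w2|.
Proof.
move=> e0 S1 S2 n1 n2.
have -> : w2 - w1 = - (w1 - w2) by rewrite opprB.
rewrite normrN linearNr /= => h1 h2.
have E : dot (x1 - w1 + (s1 - w1)) (w1 - w2) - dot (x2 - w2 + (s2 - w2)) (w1 - w2) =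
  dot (x1 - x2) (w1 - w2) - `|w1 - w2| ^+ 2 + dot (s1 - w1) (w1 - w2) - dot (s2 - w2) (w1 - w2).
  have -> : `|w1 - w2| ^+ 2 = dot w1 (w1 - w2) - dot w2 (w1 - w2).
    by rewrite Hdot linearBl.
  by move: (w1 - w2) => D; rewrite !linearDl !linearNl /=; ring.
have := dot_le_norm Hdot (s1 - w1) (w1 - w2).
have := dot_ge_norm Hdot (s2 - w2) (w1 - w2).
have : `|s1 - w1| * `|w1 - w2| <= e * `|w1 - w2| by rewrite ler_wpM2r.
have : `|s2 - w2| * `|w1 - w2| <= e * `|w1 - w2| by rewrite ler_wpM2r.
lra.
Qed.

(** In the application X = x1 - x2, D = w1 - w2, Z = z1 - z2 and k = 1 / rho.
    The terms of F beyond (a + e) k + e leave room for 3 e |D|^2 and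
    (3 / 2) eta |D|^2, which absorb the cross terms 4 e |D| and 4 eta |D| coming
    from |Z|^2 <= (|D| + 2 e + 2 eta)^2. *)
Lemma hypomonotone_perturbed (X D Z : H) (a k e eta F : R) :
  0 <= a -> 0 <= k -> 0 <= e -> 0 <= eta ->
  (1 - (a + e) * k) * `|D| ^+ 2 <= dot X D + 2 * e * `|D| ->
  `|Z - D| <= 2 * e + 2 * eta ->
  F = a * k + 4 * e * (1 + k) + 3 * eta / 2 + (4 * e + a) * k * (4 * e + 2 * eta) ->
  F <= 1 ->
  (1 - F) * `|Z| ^+ 2 <= (e + eta / 2) * `|X| ^+ 2
    + ((4 * e + a) * k * (16 * e + 16 * eta + 4) + 24 * e + 20 * eta + 11) * e
    + ((4 * e + a) * k * (4 * eta + 2) + 4 * eta + 5) * eta + dot X Z.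
Proof.
move=> a0 k0 e0 eta0 hD hZ FE F1.
have c0 : 0 <= (4 * e + a) * k by rewrite mulr_ge0 // addr_ge0 // mulr_ge0.
have F0 : 0 <= F.
  by rewrite FE !addr_ge0 // ?mulr_ge0 // ?addr_ge0 // ?mulr_ge0.
have ZD : `|Z| <= `|D| + (2 * e + 2 * eta).
  by rewrite -(subrK D Z) addrC (le_trans (ler_normD _ _)) // lerD2l.
have XD : dot X D <= dot X Z + `|X| * (2 * e + 2 * eta).
  have := dot_ge_norm Hdot X (Z - D); rewrite linearBr /=.
  have : `|X| * `|Z - D| <= `|X| * (2 * e + 2 * eta) by rewrite ler_wpM2l.
  lra.
move: hD XD; move: (dot X D) (dot X Z) => p q hD XD.
have Z2 : (1 - F) * `|Z| ^+ 2 <= (1 - F) * (`|D| + (2 * e + 2 * eta)) ^+ 2.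
  by rewrite ler_wpM2l ?subr_ge0 // ler_pXn2r ?nnegrE ?addr_ge0 ?mulr_ge0.
apply: (le_trans Z2).
move: hD XD (normr_ge0 D) (normr_ge0 X).
move: `|D| `|X| => n x hD XD n0 x0.
(* X1 to N3 are Young inequalities, one for each product of an error with a norm. *)
have X1 : 2 * e * x <= e * x ^+ 2 + e by have := mulr_ge0 e0 (sqr_ge0 (x - 1)); lra.
have X2 : 2 * eta * x <= eta / 2 * x ^+ 2 + 2 * eta.
  by have := mulr_ge0 eta0 (sqr_ge0 (x - 2)); lra.
have N1 : 2 * e * n <= e * n ^+ 2 + e by have := mulr_ge0 e0 (sqr_ge0 (n - 1)); lra.
have N2 : 4 * e * n <= 3 * e * n ^+ 2 + 2 * e.
  by have := mulr_ge0 e0 (sqr_ge0 (3 * n - 2)); lra.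
have N3 : 4 * eta * n <= 3 / 2 * eta * n ^+ 2 + 3 * eta.
  by have := mulr_ge0 eta0 (sqr_ge0 (3 * n - 4)); lra.
have G2 : (1 - F) * (2 * n * (2 * e + 2 * eta) + (2 * e + 2 * eta) ^+ 2)
    <= 2 * n * (2 * e + 2 * eta) + (2 * e + 2 * eta) ^+ 2.
  rewrite ler_piMl //; last lra.
  by rewrite addr_ge0 ?sqr_ge0 ?mulr_ge0 ?addr_ge0 ?mulr_ge0.
have S1 : 0 <= (3 * e * k + (4 * e + a) * k * (4 * e + 2 * eta)) * n ^+ 2.
  by rewrite mulr_ge0 ?sqr_ge0 // addr_ge0 // mulr_ge0 // ?mulr_ge0 // addr_ge0 // mulr_ge0.
have M1 : 0 <= (4 * e + a) * k * (16 * e + 16 * eta + 4) * e.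
  by rewrite mulr_ge0 // mulr_ge0 // !addr_ge0 // mulr_ge0.
have M2 : 0 <= (4 * e + a) * k * (4 * eta + 2) * eta.
  by rewrite mulr_ge0 // mulr_ge0 // !addr_ge0 // mulr_ge0.
have M3 := mulr_ge0 e0 eta0; have M4 := sqr_ge0 e; have M5 := sqr_ge0 eta.
have E1 : (1 - F) * n ^+ 2 = (1 - (a + e) * k) * n ^+ 2
   - (4 * e + 3 * eta / 2) * n ^+ 2 - (3 * e * k + (4 * e + a) * k * (4 * e + 2 * eta)) * n ^+ 2.
  by rewrite FE; field.
have -> : (1 - F) * (n + (2 * e + 2 * eta)) ^+ 2 = (1 - F) * n ^+ 2 +
  (1 - F) * (2 * n * (2 * e + 2 * eta) + (2 * e + 2 * eta) ^+ 2) by ring.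
(* Naming the products makes the remaining inequality linear. *)
rewrite E1; move: S1 M1 M2 hD G2.
set c1 := (3 * e * k + _) * _; set c2 := (1 - _ * _) * _.
set c3 := (1 - F) * _ => S1 M1 M2 hD G2.
lra.
Qed.

(** Taking for a the larger of the two distances gives both normals the same
    bound a + e. *)
Lemma approx_proj_hypomonotone (Seta : R -> set H)
    (HSeta : closed_approximation S Seta) (eps eta a e F : R) (x1 x2 z1 z2 : H) :
  0 < eps -> 0 < eta -> 0 <= e ->
  rdist S x1 <= a -> rdist S x2 <= a ->
  e ^+ 2 = eps + 2 * eta * (a + Num.sqrt eps) + eta ^+ 2 ->
  (((a + e) / 2)%:E < rho)%E -> S !=set0 ->
  F = a * K + 4 * e * (1 + K) + 3 * eta / 2 + (4 * e + a) * K * (4 * e + 2 * eta) ->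
  F <= 1 ->
  approx_proj S Seta eps eta x1 z1 -> approx_proj S Seta eps eta x2 z2 ->
  (1 - F) * `|z1 - z2| ^+ 2 <= (e + eta / 2) * `|x1 - x2| ^+ 2
    + ((4 * e + a) * K * (16 * e + 16 * eta + 4) + 24 * e + 20 * eta + 11) * e
    + ((4 * e + a) * K * (4 * eta + 2) + 4 * eta + 5) * eta
    + dot (x1 - x2) (z1 - z2).
Proof.
move=> eps0 eta0 e0 a1 a2 eE small S0 FE F1 P1 P2.
have step x z : rdist S x <= a -> approx_proj S Seta eps eta x z ->
  exists s w, [/\ S w, `|z - s| <= eta, `|s - w| <= e & forall s', S s' ->
    dot (x - w + (s - w)) (s' - w) <= (a + e) / 2 * K * `|s' - w| ^+ 2].
  move=> xa /(approx_proj_shadow HSeta S0 eps0 eta0)[s [Ss zs xs]].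
  have {}xs : `|x - s| ^+ 2 <= rdist S x ^+ 2 + e ^+ 2.
    apply: (le_trans xs); rewrite eE lerD2l lerD2r lerD2l ler_pM2l ?lerD2r //.
    by rewrite mulr_gt0.
  have sm : (((rdist S x + e) / 2)%:E < rho)%E.
    by apply: le_lt_trans small; rewrite lee_fin; lra.
  have [w [Sw sw wP]] := exists_nearby_normal Ss e0 xs sm; exists s, w; split => // s' Ss'.
  apply: (le_trans (wP _ Ss')); rewrite -!mulrA ler_wpM2r ?lerD2r //.
  by rewrite !mulr_ge0 ?curvature_ge0 ?exprn_ge0.
have [s1 [w1 [S1 zs1 sw1 h1]]] := step _ _ a1 P1.
have [s2 [w2 [S2 zs2 sw2 h2]]] := step _ _ a2 P2.
have a0 : 0 <= a by exact: le_trans (rdist_ge0 S x1) a1.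
have h := normal_hypomonotone e0 S1 S2 sw1 sw2 (h1 _ S2) (h2 _ S1).
apply: (hypomonotone_perturbed a0 curvature_ge0 e0 (ltW eta0) h _ FE F1).
have -> : z1 - z2 - (w1 - w2) = (z1 - w1) - (z2 - w2).
  by rewrite !opprB [w2 - w1]addrC addrACA [- z2 + w2]addrC.
have := ler_normB (z1 - w1) (z2 - w2).
by have := ler_distD s1 z1 w1; have := ler_distD s2 z2 w2; lra.
Qed.

End ProxRegular.

End Prox.

(** * The two parts of the proposition *)

Theorem proposition2p9 (R : realType) (H : completeNormedModType R)
    (dot : {dot H for idfun}) (Hdot : induces_norm dot)
    (rho : \bar R) (rho_gt0 : (0 < rho)%E)
    (S : set H) (HS : prox_regular dot rho S)
    (Seta : R -> set H) (HSeta : closed_approximation S Seta) :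
  (forall (x_ : nat -> H) (x : H), x_ @ \oo --> x -> tube S rho x ->
     forall (z_ : nat -> H) (eps_ eta_ : nat -> R),
       (forall n, 0 < eps_ n) -> (forall n, 0 < eta_ n) ->
       eps_ @ \oo --> (0 : R) -> eta_ @ \oo --> (0 : R) ->
       (forall n, approx_proj S Seta (eps_ n) (eta_ n) (x_ n) (z_ n)) ->
       z_ @ \oo --> metric_proj S x)
  /\
  (forall r : R, rho = r%:E ->
     forall gamma eta eta0 eps eps0 : R,
       0 < gamma < 1 -> 0 < eta < r ->
       0 < eta0 -> 0 < eps0 ->
       0 < eta < eta0 -> 0 < eps <= eps0 ->
       let beta0 := Num.sqrt eps0 + eta0 + Num.sqrt (2 * eta0 * gamma * r) in
       gamma + 4 * beta0 * (1 + 1 / r) + 3 * eta0 / 2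
         + (4 * beta0 / r + gamma) * (4 * beta0 + 2 * eta0) = 1 ->
       forall x1 x2 z1 z2 : H,
         tube S (gamma * r)%:E x1 -> tube S (gamma * r)%:E x2 ->
         approx_proj S Seta eps eta x1 z1 ->
         approx_proj S Seta eps eta x2 z2 ->
         let alpha := Num.max (fine (dist_set S x1)) (fine (dist_set S x2)) in
         let eps' := eps + 2 * eta * (alpha + Num.sqrt eps) + eta ^+ 2 in
         let F := alpha / r + 4 * Num.sqrt eps' * (1 + 1 / r) + 3 * eta / 2
           + (4 * Num.sqrt eps' + alpha) / r * (4 * Num.sqrt eps' + 2 * eta) in
         let M := (4 * Num.sqrt eps' + alpha) / r
             * (16 * Num.sqrt eps' + 16 * eta + 4)
           + 24 * Num.sqrt eps' + 20 * eta + 11 in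
         let N := (4 * Num.sqrt eps' + alpha) / r * (4 * eta + 2)
           + 4 * eta + 5 in
         (1 - F) * `|z1 - z2| ^+ 2 <=
           (Num.sqrt eps' + eta / 2) * `|x1 - x2| ^+ 2
           + M * Num.sqrt eps' + N * eta + dot (x1 - x2) (z1 - z2)).
Proof.
split=> [x_ x xx tx z_ eps_ eta_ eps0 eta0 epsc etac zP|].
  exact: (@approx_proj_cvg _ _ _ Hdot _ rho_gt0 _ HS _ HSeta _ _ _ _ _ xx tx
    eps0 eta0 epsc etac zP).
move=> r rhoE gamma eta eta0 eps eps0 /andP[g0 g1] /andP[eta_gt0 _] eta0_gt0 eps0_gt0.
move=> /andP[_ eta_lt] /andP[eps_gt0 eps_le] beta0 budget x1 x2 z1 z2 t1 t2 P1 P2.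
pose alpha := Num.max (rdist S x1) (rdist S x2).
pose eps' := eps + 2 * eta * (alpha + Num.sqrt eps) + eta ^+ 2.
pose e := Num.sqrt eps'.
pose F := alpha / r + 4 * e * (1 + 1 / r) + 3 * eta / 2
  + (4 * e + alpha) / r * (4 * e + 2 * eta).
have r0 : 0 < r by rewrite -lte_fin -rhoE.
have gr0 : 0 < gamma * r by rewrite mulr_gt0.
have KE : fine (rho^-1)%E = r^-1 by rewrite rhoE inver gt_eqF.
have S0 : S !=set0 := tube_nonempty t1.
have a1 : rdist S x1 <= alpha by rewrite le_max lexx.
have a2 : rdist S x2 <= alpha by rewrite le_max lexx orbT.
have a0 : 0 <= alpha := le_trans (rdist_ge0 S x1) a1.
have ag : alpha < gamma * r.
  rewrite gt_max -!lte_fin; move: t1 t2; rewrite /tube /= !rdistE // => t1 t2.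
  by rewrite t1 t2.
have e0 : 0 <= e by exact: sqrtr_ge0.
have eps'0 : 0 <= eps'.
  by rewrite /eps' !addr_ge0 ?sqr_ge0 ?(ltW eps_gt0) // !mulr_ge0 ?addr_ge0 // ltW.
have eE : e ^+ 2 = eps' by exact: sqr_sqrtr.
(* eps' is (sqrt eps + eta)^2 + 2 eta alpha with alpha < gamma r; the three
   summands of beta0 dominate the square roots of its parts. *)
have eb : e <= beta0.
  have q0 : 0 <= 2 * eta0 * gamma * r by rewrite !mulr_ge0 // ltW.
  rewrite -(@ler_pXn2r _ 2) ?nnegrE ?addr_ge0 ?(ltW eta0_gt0) // eE /beta0.
  set s0 := Num.sqrt eps0; set q := Num.sqrt (_ * r).
  have qE : q ^+ 2 = 2 * eta0 * gamma * r by exact: sqr_sqrtr.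
  have ss : Num.sqrt eps <= s0 by rewrite ler_sqrt // ltW.
  have sE := sqr_sqrtr (ltW eps_gt0).
  have h1 : (Num.sqrt eps + eta) ^+ 2 <= (s0 + eta0) ^+ 2.
    by rewrite ler_pXn2r ?nnegrE ?addr_ge0 ?sqrtr_ge0 ?(ltW eta_gt0) ?(ltW eta0_gt0) // lerD // ltW.
  have h2 : eta * alpha <= eta0 * (gamma * r) by rewrite ler_pM // ltW.
  have h3 : 0 <= (s0 + eta0) * q by rewrite mulr_ge0 ?addr_ge0 ?sqrtr_ge0 ?(ltW eta0_gt0).
  rewrite /eps'; lra.
have i0 : 0 <= r^-1 by rewrite invr_ge0 ltW.
have ai : alpha * r^-1 <= gamma by rewrite ler_pdivrMr // ltW.
have eta_le := ltW eta_lt.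
have b0 : 0 <= beta0 := le_trans e0 eb.
have eib : e * r^-1 <= beta0 * r^-1 by rewrite ler_wpM2r.
have F1 : F <= 1.
  rewrite -budget /F.
  have h1 : (4 * e + alpha) / r * (4 * e + 2 * eta) <=
      (4 * beta0 / r + gamma) * (4 * beta0 + 2 * eta0).
    apply: ler_pM; rewrite ?divr_ge0 ?addr_ge0 ?mulr_ge0 ?(ltW r0) ?(ltW eta_gt0) //; lra.
  lra.
(* The term 4 beta0 / r alone is at most 1, so e < r; with alpha < gamma r < r
   the mean of alpha and e is below r. *)
have bi : beta0 * r^-1 <= 1 / 4.
  have : 0 <= (4 * beta0 / r + gamma) * (4 * beta0 + 2 * eta0).
    by rewrite mulr_ge0 // !addr_ge0 // ?mulr_ge0 // ?(ltW eta0_gt0) // ltW.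
  lra.
have er : e < r.
  have : e * r^-1 < 1 by lra.
  by rewrite ltr_pdivrMr // mul1r.
have small : (((alpha + e) / 2)%:E < rho)%E.
  have : gamma * r < r by rewrite gtr_pMl.
  by rewrite rhoE lte_fin; lra.
have := approx_proj_hypomonotone Hdot rho_gt0 HS HSeta
  eps_gt0 eta_gt0 e0 a1 a2 eE small S0 _ F1 P1 P2.
rewrite KE => /(_ ltac:(by rewrite /F div1r)); exact.
Qed.
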